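(* For every finite digraph $D$ with maximum out-degree $\Delta^+=\Delta^+(D)$ and maximum in-degree $\Delta^-=\Delta^-(D)$, there is a digraph $D'$ with the following properties: (a) $c(D') \ge c(D)$; (b) $\Delta^+(D')\le 2$ and $\Delta^-(D')\le 2$; (c) $|V(D')| \le 4(\Delta^- + \Delta^+)\,|V(D)|$.
   Context: Cops and Robbers on a digraph $D$: first the cops (a fixed number of them) choose initial vertices, then the robber, knowing their positions, chooses an initial vertex. Thereafter the players alternate, cops first: on a turn, each cop (respectively the robber) either stays at its current vertex $u$ or moves to an out-neighbour of $u$, i.e. along an arc $u\to w$. The cops win if at some point a cop occupies the same vertex as the robber. The cop number $c(D)$ is the minimum number of cops that can guarantee capturing the robber on $D$. $\Delta^+(D)$ and $\Delta^-(D)$ denote the maximum out-degree and maximum in-degree of $D$.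
   Formalization: The formal statement assumes that D (loopless, without parallel arcs) has at least one arc: for nonempty D without arcs, Δ⁺=Δ⁻=0, so (c) forces V(D') to be empty and (a) fails; the empty digraph is excluded too. *)

(* Defs.v *)
From mathcomp Require Import all_boot.
From mathcomp Require Import boolp.

Set Implicit Arguments.
Unset Strict Implicit.
Unset Printing Implicit Defensive.

(* Finite digraphs, without loops or parallel arcs; 2-cycles are allowed. *)
Record digraph := Digraph {
  vertex :> finType;
  is_arc : rel vertex;
  is_arc_irr : irreflexive is_arc
}.

Section Game.
Variable D : digraph.

Definition out_degree (v : D) : nat := #|[set w | is_arc v w]|.
Definition in_degree (v : D) : nat := #|[set u | is_arc u v]|.
Definition max_out_degree : nat := \max_(v : D) out_degree v.
Definition max_in_degree : nat := \max_(v : D) in_degree v.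

Definition legal_step (u w : D) : bool := (w == u) || is_arc u w.

(* r 0 is the robber's initial vertex, r t the vertex after its t-th move. *)
Definition robber_play (r : nat -> D) : Prop :=
  forall t, legal_step (r t) (r t.+1).

(* A deterministic strategy of k cops gives their positions as a function of
   the robber's past positions: s [::] is the initial placement, and
   s [:: r 0; ...; r t] is the placement after the cops' (t+1)-st move, made
   when the robber stands at r t. *)
Definition cop_strategy (k : nat) := seq D -> 'I_k -> D.

Definition legal_strategy (k : nat) (s : cop_strategy k) : Prop :=
  forall r, robber_play r -> forall t i,
    legal_step (s (mkseq r t) i) (s (mkseq r t.+1) i).

(* The robber at r t first faces the cops at s (mkseq r t) (it has just moved
   or chosen its initial vertex), then at s (mkseq r t.+1) (they have just
   moved). Since the strategy is fixed before r, quantifying over all plays r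
   also covers robbers that react to the cops. *)
Definition captures (k : nat) (s : cop_strategy k) (r : nat -> D) : Prop :=
  exists t i, s (mkseq r t) i = r t \/ s (mkseq r t.+1) i = r t.

Definition cops_win (k : nat) : Prop :=
  exists s : cop_strategy k,
    legal_strategy s /\ forall r, robber_play r -> captures s r.

Lemma ex_cops_win : exists k, `[< cops_win k >].
Proof.
exists #|D|; apply/asboolP; exists (fun _ i => enum_val i); split.
  by move=> r _ t i; rewrite /legal_step eqxx.
by move=> r _; exists 0, (enum_rank (r 0)); left; rewrite enum_rankK.
Qed.

Definition cop_number : nat := ex_minn ex_cops_win.

End Game.

(* Main.v *)
(** Replace every vertex of D by a binary in-tree of depth g followed by a binary
out-tree of depth h, where 2^g and 2^h are the least powers of two bounding the
maximum in- and out-degree, and route each arc from a leaf of an out-tree to a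
leaf of an in-tree. Every walk in D' changes fibre exactly once in L = h + g + 2
arcs, so sampling the cops on D' every L moves and projecting them to D gives
legal cop moves on D. The robber on D is lifted to one that walks from in-root
to in-root in L moves. If a cop catches the lifted robber at a vertex x, then
x lies over the start or the end of the arc being traversed, and the cop was in
the fibre of x at the previous sample in the first case, and still is at the next
one in the second; so the projected cop catches the robber on D. *)

Require Import Defs.
From mathcomp Require Import all_boot.
From mathcomp Require Import zify boolp.

Set Implicit Arguments.
Unset Strict Implicit.
Unset Printing Implicit Defensive.

(** * Transfer of cop strategies from a fibred digraph to its base *)

Section Projection.

Variables (D D' : digraph) (f : D' -> D) (b : D' -> nat) (L : nat).
Variables (c : D -> D') (p : D -> D -> nat -> D').

(* b x is the number of arcs up to and including the next change of fibre. *)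
Hypothesis b_gt0 : forall x, 0 < b x.
Hypothesis arc_project : forall x y, is_arc x y ->
  (f x = f y /\ b x = (b y).+1) \/ [/\ is_arc (f x) (f y), b x = 1 & b y = L].
Hypothesis f_c : forall v, f (c v) = v.
Hypothesis b_c : forall v, 1 < b (c v).
Hypothesis p_start : forall v w, p v w 0 = c v.
Hypothesis p_step : forall v w, legal_step v w ->
  forall j, j < L -> legal_step (p v w j) (p v w j.+1).
Hypothesis p_end : forall v w, legal_step v w -> p v w L = c w.
(* A cop catching the robber at p v w j within a round does so after its k-th move
   of that round, with k = j or k = j.+1; it was over v at the sample after its
   first move, or will be over w at the next sample. *)
Hypothesis p_project : forall v w j k, legal_step v w ->
  j < L -> 0 < k -> j <= k <= j.+1 ->
  (f (p v w j) = v /\ k + b (p v w j) <= L.+1) \/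
  (f (p v w j) = w /\ L.+1 < b (p v w j) + k).
Hypothesis L_gt0 : 0 < L.

Lemma step_project x y : legal_step x y ->
  [\/ x = y, f x = f y /\ b x = (b y).+1 |
      [/\ is_arc (f x) (f y), b x = 1 & b y = L]].
Proof.
case/orP=> [/eqP->|/arc_project[]]; first by constructor 1.
  by constructor 2.
by constructor 3.
Qed.

Lemma legal_step_project x y : legal_step x y -> legal_step (f x) (f y).
Proof.
by rewrite /legal_step => /step_project[->|[-> _]|[-> _ _]]; rewrite ?eqxx ?orbT.
Qed.

Section Walk.
Variable q : nat -> D'.
Hypothesis q_step : robber_play q.

(** Each move within a fibre lowers [b] by at most one, and leaving the fibre requires [b] to be
    1. *)
Lemma walk_forward m n : n < b (q m) ->
  f (q (m + n)) = f (q m) /\ b (q m) <= b (q (m + n)) + n.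
Proof.
elim: n => [|n IH] ltn; first by rewrite addn0 addn0.
have [|fn bn] := IH; first by lia.
rewrite addnS; case: (step_project (q_step (m + n))) => [<-|[<- ?]|[_ ? _]].
- by split=> //; lia.
- by split=> //; lia.
- by lia.
Qed.

(** Entering a fibre resets [b] to [L], so a value of at most [L - n] rules out an entry during the
    last [n] moves. *)
Lemma walk_backward m n : n + b (q (m + n)) <= L ->
  f (q m) = f (q (m + n)) /\ b (q m) <= b (q (m + n)) + n.
Proof.
elim: n m => [|n IH] m; first by rewrite !addn0.
rewrite addnS -addSn => le_L; have [|<- bn] := IH m.+1; first by lia.
by case: (step_project (q_step m)) => [->|[-> ->]|[_ _ ?]]; split=> //; lia.
Qed.

(** After a change of fibre [b] must run down from [L] to 1 before the next one, so two changes take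
    more than [L] moves. *)
Lemma walk_period m : legal_step (f (q m)) (f (q (m + L))).
Proof.
suff H n : n <= L ->
    (f (q (m + n)) = f (q m) /\ b (q m) <= b (q (m + n)) + n) \/
    (is_arc (f (q m)) (f (q (m + n))) /\ L + b (q m) <= b (q (m + n)) + n).
  by case: (H L (leqnn L)) => -[e _]; rewrite /legal_step e ?eqxx ?orbT.
elim: n => [|n IH] ltn; first by left; rewrite addn0 addn0.
have bm := b_gt0 (q m); rewrite addnS.
case: IH => [|[fn bn]|[fn bn]]; first by lia.
  case: (step_project (q_step (m + n))) => [<-|[<- ?]|[a ? ->]].
  - by left; split=> //; lia.
  - by left; split=> //; lia.
  - by right; rewrite -fn; split=> //; lia.
case: (step_project (q_step (m + n))) => [<-|[<- ?]|[a ? _]].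
- by right; split=> //; lia.
- by right; split=> //; lia.
- by lia.
Qed.

End Walk.

Definition lift_play (r : nat -> D) (n : nat) : D' :=
  p (r (n %/ L)) (r (n %/ L).+1) (n %% L).

Lemma lift_play_robber r : robber_play r -> robber_play (lift_play r).
Proof.
move=> r_step n; rewrite /lift_play.
have lt_mod : n %% L < L by rewrite ltn_mod.
have [lt|ge] := ltnP (n %% L).+1 L.
  have -> : n.+1 %/ L = n %/ L.
    by rewrite {1}(divn_eq n L) -addnS divnMDl // (divn_small lt) addn0.
  have -> : n.+1 %% L = (n %% L).+1.
    by rewrite {1}(divn_eq n L) -addnS modnMDl modn_small.
  exact: p_step.
have eL : (n %% L).+1 = L by lia.
have e : n.+1 = (n %/ L).+1 * L by rewrite {1}(divn_eq n L) -addnS eL mulSn addnC.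
have -> : n.+1 %/ L = (n %/ L).+1 by rewrite {1}e mulnK.
have -> : n.+1 %% L = 0 by rewrite {1}e modnMl.
rewrite p_start.
by have := p_step (r_step (n %/ L)) lt_mod; rewrite eL p_end.
Qed.

(** By [p_start], the lifted position at time [t * L] does not depend on [r t.+1], so the projected
    cops need no knowledge of the robber's future. *)
Lemma eq_lift_play r r' t :
  (forall i, i <= t -> r i = r' i) ->
  mkseq (lift_play r) (t * L).+1 = mkseq (lift_play r') (t * L).+1.
Proof.
move=> eq_r; apply/eq_in_map => i; rewrite mem_iota ltnS /= /lift_play => le_i.
have [lt|ge] := ltnP i (t * L).
  have lt_t : i %/ L < t by rewrite ltn_divLR.
  by rewrite (eq_r _ lt_t) (eq_r _ (ltnW lt_t)).
have -> : i = t * L by lia.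
by rewrite mulnK // modnMl !p_start eq_r.
Qed.

(* After the robber's positions r 0, ..., r t the cops on D shadow those on D'
   at the first cop move made with the lifted robber standing at c (r t). *)
Definition project_strategy k (s : cop_strategy D' k) (v0 : D) : cop_strategy D k :=
  fun h i => if h is [::] then f (s [::] i)
    else f (s (mkseq (lift_play (nth v0 h)) ((size h).-1 * L).+1) i).

(** The default [v0] stands in for the robber's unknown later positions, which are harmless by
    [eq_lift_play]. *)
Lemma project_strategyS k (s : cop_strategy D' k) v0 r t i :
  project_strategy s v0 (mkseq r t.+1) i =
  f (s (mkseq (lift_play r) (t * L).+1) i).
Proof.
rewrite /project_strategy; case e: (mkseq r t.+1) => [//|x h].
rewrite -e size_mkseq /=; congr (f (s _ i)); apply: eq_lift_play => j le_j.
by rewrite nth_mkseq.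
Qed.

Lemma cops_win_project k : D -> cops_win D' k -> cops_win D k.
Proof.
move=> v0 [s [s_legal s_win]]; exists (project_strategy s v0).
have s_walk r i : robber_play r ->
    robber_play (fun n => s (mkseq (lift_play r) n) i).
  by move=> /lift_play_robber r_step n; apply: s_legal.
split=> r r_step.
  (* The first projected move is a single cop move on [D']; each later one gathers [L] moves. *)
  move=> [|t] i; rewrite project_strategyS.
    exact: (legal_step_project (s_walk r i r_step 0)).
  rewrite project_strategyS mulSn addnC -addSn.
  exact: (walk_period (s_walk r i r_step)).
have [n [i cap]] := s_win _ (lift_play_robber r_step).
set q := fun n => s (mkseq (lift_play r) n) i.
pose t := n %/ L; pose j := n %% L.
have n_eq : n = t * L + j by apply: divn_eq.
have lt_j : j < L by rewrite ltn_mod.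
have [m [cap_m le_m]] : exists m, q m = lift_play r n /\ n <= m <= n.+1.
  by case: cap; [exists n | exists n.+1]; split=> //; lia.
(* Sample [t] is taken after [(t * L).+1] cop moves. A capture just before it happens at [c (r t)],
   and [b_c] keeps the cop in that fibre for one more move. *)
have [lt_m|ge_m] := ltnP (t * L) m; last first.
  have [em ej] : m = t * L /\ j = 0 by lia.
  have qm : q (t * L) = c (r t).
    by rewrite -em cap_m /lift_play -/t -/j ej p_start.
  have [|fm _] := walk_forward (s_walk r i r_step) (m := t * L) (n := 1).
    by rewrite -/(q _) qm.
  exists t, i; right; rewrite project_strategyS -addn1 fm -/(q _) qm.
  exact: f_c.
have := @p_project (r t) (r t.+1) j (m - t * L) (r_step t) lt_j.
rewrite -[p _ _ _]/(lift_play r n) -cap_m; case; [lia|lia| |].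
  case=> fm bm; exists t, i; right; rewrite project_strategyS -fm.
  have em : m = (t * L).+1 + (m - (t * L).+1) by lia.
  have [|-> _] := walk_backward (s_walk r i r_step) (m := (t * L).+1)
    (n := m - (t * L).+1); first by rewrite -em -/(q m); lia.
  by rewrite -em.
case=> fm bm; exists t.+1, i; right; rewrite project_strategyS -fm.
have -> : (t.+1 * L).+1 = m + ((t.+1 * L).+1 - m) by lia.
by have [] := walk_forward (s_walk r i r_step) (m := m)
  (n := (t.+1 * L).+1 - m); first by rewrite -/(q m); lia.
Qed.

End Projection.

(** * The binary-tree digraph and its degrees *)

Section Binarization.

Variables (D : digraph) (h g : nat).

(* A complete binary tree of depth n: the root is 1, the parent of m is m./2 and
   the leaves are 2 ^ n, ..., 2 ^ n.+1 - 1; index 0 is an isolated extra vertex. *)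
Definition heap (n : nat) := 'I_(2 ^ n.+1).-1.+1.

Lemma heap_lt n (m : heap n) : m < 2 ^ n.+1.
Proof. by apply: leq_trans (ltn_ord m) _; rewrite prednK ?expn_gt0. Qed.

Lemma heap_half_lt n (m : heap n) : m./2 < 2 ^ n.
Proof. by rewrite -(ltn_pmul2l (m := 2)) // -expnS; have := heap_lt m; lia. Qed.

Lemma heap_inordK n m : m < 2 ^ n.+1 -> @inord (2 ^ n.+1).-1 m = m :> nat.
Proof. by move=> lt_m; rewrite inordK // prednK ?expn_gt0. Qed.

Definition out_leaf (v w : D) : nat := 2 ^ h + index w (enum [set w | is_arc v w]).
Definition in_leaf (v w : D) : nat := 2 ^ g + index v (enum [set u | is_arc u w]).

Definition bin_vertex : finType := (D * (heap h + heap g))%type.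

(** The guards [0 < m] and [0 < n] isolate index 0, which is its own half and the half of 1. *)
Definition bin_arc (x y : bin_vertex) : bool :=
  match x, y with
  | (v, inl m), (w, inl n) => [&& v == w, 0 < m & n./2 == m]
  | (v, inl m), (w, inr n) =>
      [&& is_arc v w, m == out_leaf v w :> nat & n == in_leaf v w :> nat]
  | (v, inr m), (w, inr n) => [&& v == w, 0 < n & m./2 == n]
  | (v, inr m), (w, inl n) => [&& v == w, m == 1 :> nat & n == 1 :> nat]
  end.

Lemma bin_arc_irr : irreflexive bin_arc.
Proof. by move=> [v [m|m]] /=; apply/negP => /and3P[]; lia. Qed.

Definition binarization : digraph := Digraph bin_arc_irr.

Lemma out_leaf_inj v w w' : is_arc v w -> is_arc v w' ->
  out_leaf v w = out_leaf v w' -> w = w'.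
Proof.
move=> vw vw' /addnI e.
by rewrite -[w](@nth_index _ v w (enum [set w | is_arc v w]))
  ?mem_enum ?inE // e nth_index ?mem_enum ?inE.
Qed.

Lemma in_leaf_inj v v' w : is_arc v w -> is_arc v' w ->
  in_leaf v w = in_leaf v' w -> v = v'.
Proof.
move=> vw v'w /addnI e.
by rewrite -[v](@nth_index _ w v (enum [set u | is_arc u w]))
  ?mem_enum ?inE // e nth_index ?mem_enum ?inE.
Qed.

(** Parity separates the two children [2m] and [2m + 1] of a tree node. *)
Definition bin_parity (x : bin_vertex) : bool :=
  match x.2 with inl m => odd m | inr m => odd m end.

Lemma card_parity_le2 (A : {set bin_vertex}) :
  {in A &, injective bin_parity} -> #|A| <= 2.
Proof.
by move=> inj; rewrite -card_bool -(card_in_imset inj) max_card.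
Qed.

Lemma max_out_degree_binarization : max_out_degree binarization <= 2.
Proof.
have leaf_ge v w : 2 ^ h <= out_leaf v w by apply: leq_addr.
apply/bigmax_leqP => -[v m] _; apply: card_parity_le2.
move=> [w n] [w' n']; rewrite !inE /bin_parity /=.
case: m n n' => m [] n [] n'.
- case/and3P=> /eqP<- _ /eqP e /and3P[/eqP<- _ /eqP e'] par.
  by congr (_, inl _); apply: val_inj => /=; lia.
(* An out-tree arc starts at an index below [2 ^ h], an arc between fibres at a leaf, so no vertex
   has both. *)
- case/and3P=> _ _ /eqP e /and3P[_ /eqP e' _].
  by have := heap_half_lt n; have := leaf_ge v w'; lia.
- case/and3P=> _ /eqP e _ /and3P[_ _ /eqP e'].
  by have := heap_half_lt n'; have := leaf_ge v w; lia.
- case/and3P=> vw /eqP e /eqP en /and3P[vw' /eqP e' /eqP en'] _.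
  have eq_w : w = w' by apply: (out_leaf_inj vw vw'); rewrite -e -e'.
  by rewrite -eq_w in en' *; congr (_, inr _); apply: val_inj => /=; lia.
- case/and3P=> /eqP<- _ /eqP e /and3P[/eqP<- _ /eqP e'] _.
  by congr (_, inl _); apply: val_inj => /=; lia.
- by case/and3P=> _ /eqP ? _ /and3P[_ ? /eqP ?]; lia.
- by case/and3P=> _ ? /eqP ? /and3P[_ /eqP ? _]; lia.
- case/and3P=> /eqP<- _ /eqP e /and3P[/eqP<- _ /eqP e'] _.
  by congr (_, inr _); apply: val_inj => /=; lia.
Qed.

Lemma max_in_degree_binarization : max_in_degree binarization <= 2.
Proof.
have leaf_ge v w : 2 ^ g <= in_leaf v w by apply: leq_addr.
apply/bigmax_leqP => -[w m] _; apply: card_parity_le2.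
move=> [v n] [v' n']; rewrite !inE /bin_parity /=.
case: m n n' => m [] n [] n'.
- case/and3P=> /eqP-> _ /eqP e /and3P[/eqP-> _ /eqP e'] _.
  by congr (_, inl _); apply: val_inj => /=; lia.
- by case/and3P=> _ ? /eqP ? /and3P[_ _ /eqP ?]; lia.
- by case/and3P=> _ _ /eqP ? /and3P[_ ? /eqP ?]; lia.
- case/and3P=> /eqP-> /eqP e _ /and3P[/eqP-> /eqP e' _] _.
  by congr (_, inr _); apply: val_inj => /=; lia.
- case/and3P=> vw /eqP en /eqP e /and3P[v'w /eqP en' /eqP e'] _.
  have eq_v : v = v' by apply: (in_leaf_inj vw v'w); rewrite -e -e'.
  by rewrite -eq_v in en' *; congr (_, inl _); apply: val_inj => /=; lia.
- case/and3P=> _ _ /eqP e /and3P[_ _ /eqP e'].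
  by have := heap_half_lt n'; have := leaf_ge v w; lia.
- case/and3P=> _ _ /eqP e /and3P[_ _ /eqP e'].
  by have := heap_half_lt n; have := leaf_ge v' w; lia.
- case/and3P=> /eqP-> _ /eqP e /and3P[/eqP-> _ /eqP e'] par.
  by congr (_, inr _); apply: val_inj => /=; lia.
Qed.

Lemma card_binarization : #|binarization| = (2 ^ h.+1 + 2 ^ g.+1) * #|D|.
Proof.
by rewrite card_prod card_sum !card_ord !prednK ?expn_gt0 // mulnC.
Qed.

(** This is the countdown [b]: [trunc_log 2 m] is the depth of [m], and an in-tree vertex must climb
    to its root before the descent of the out-tree. *)
Definition bin_distance (x : bin_vertex) : nat :=
  match x.2 with
  | inl m => h.+1 - trunc_log 2 m
  | inr m => h.+2 + trunc_log 2 m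
  end.

Definition in_root (v : D) : bin_vertex := (v, inr (inord 1)).

(** Repeated halving of a leaf index runs through its ancestors: in reverse order it descends the
    out-tree of [v], in direct order it climbs the in-tree of [w]. *)
Definition bin_path (v w : D) (j : nat) : bin_vertex :=
  if v == w then in_root v else
  if j is i.+1 then
    if i <= h then (v, inl (inord (iter (h - i) half (out_leaf v w))))
    else (w, inr (inord (iter (i - h.+1) half (in_leaf v w))))
  else in_root v.

Lemma trunc_log_heap n (m : heap n) : trunc_log 2 m <= n.
Proof.
case: (posnP m) => [->|m_gt0]; first by rewrite trunc_log0.
rewrite -ltnS -(ltn_exp2l (m := 2)) //.
by apply: leq_ltn_trans (heap_lt m); apply: trunc_logP.
Qed.

Lemma bin_distance_gt0 x : 0 < bin_distance x.
Proof.
case: x => v [m|m]; rewrite /bin_distance //=.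
by rewrite subn_gt0 ltnS trunc_log_heap.
Qed.

Lemma iter_half_bounds n m i : 2 ^ n <= m < 2 ^ n.+1 -> i <= n ->
  2 ^ (n - i) <= iter i half m < 2 ^ (n - i).+1.
Proof.
move=> bm; elim: i => [|i IH] lt_i; first by rewrite subn0.
have := IH (ltnW lt_i); rewrite -(subnSK lt_i) iterS !expnS.
by lia.
Qed.

(** * Countdown and robber paths under the degree bounds *)

Hypothesis out_bound : forall v : D, out_degree v <= 2 ^ h.
Hypothesis in_bound : forall v : D, in_degree v <= 2 ^ g.

Lemma out_leaf_bounds v w : is_arc v w -> 2 ^ h <= out_leaf v w < 2 ^ h.+1.
Proof.
move=> vw; rewrite leq_addr /= expnS mul2n -addnn ltn_add2l.
apply: leq_trans (out_bound v).
by rewrite /out_degree cardE index_mem mem_enum inE.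
Qed.

Lemma in_leaf_bounds v w : is_arc v w -> 2 ^ g <= in_leaf v w < 2 ^ g.+1.
Proof.
move=> vw; rewrite leq_addr /= expnS mul2n -addnn ltn_add2l.
apply: leq_trans (in_bound w).
by rewrite /in_degree cardE index_mem mem_enum inE.
Qed.

Lemma in_root_val : @inord (2 ^ g.+1).-1 1 = 1 :> nat.
Proof. by rewrite heap_inordK // -[1]/(2 ^ 0) ltn_exp2l. Qed.

Lemma bin_distance_root v : bin_distance (in_root v) = h.+2.
Proof. by rewrite /bin_distance /= in_root_val trunc_log1 addn0. Qed.

Lemma bin_arc_project (x y : binarization) : is_arc x y ->
  (x.1 = y.1 /\ bin_distance x = (bin_distance y).+1) \/
  [/\ is_arc x.1 y.1, bin_distance x = 1 & bin_distance y = (h + g).+2].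
Proof.
case: x y => [v m] [w n]; rewrite /bin_distance /=; case: m n => m [] n.
- case/and3P=> /eqP<- m_gt0 /eqP e; left; split=> //.
  have := trunc_log_heap n; rewrite (@trunc_log2S n); last by lia.
  by rewrite e; lia.
- case/and3P=> vw /eqP-> /eqP->; right.
  rewrite (trunc_log_eq _ (out_leaf_bounds vw)) //.
  by rewrite (trunc_log_eq _ (in_leaf_bounds vw)) //; split=> //; lia.
- by case/and3P=> /eqP<- /eqP-> /eqP->; left; rewrite trunc_log1; split=> //; lia.
- case/and3P=> /eqP<- n_gt0 /eqP e; left; split=> //.
  by rewrite (@trunc_log2S m); [rewrite e; lia|lia].
Qed.

Lemma out_path_val v w i : is_arc v w -> i <= h ->
  2 ^ i <= @inord (2 ^ h.+1).-1 (iter (h - i) half (out_leaf v w)) < 2 ^ i.+1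
  /\ @inord (2 ^ h.+1).-1 (iter (h - i) half (out_leaf v w)) =
     iter (h - i) half (out_leaf v w) :> nat.
Proof.
move=> vw le_i.
have := iter_half_bounds (out_leaf_bounds vw) (leq_subr i h).
rewrite subKn // => bnd; rewrite heap_inordK //.
by case/andP: bnd => _ /leq_trans; apply; rewrite leq_exp2l.
Qed.

Lemma in_path_val v w i : is_arc v w -> i <= g ->
  2 ^ (g - i) <= @inord (2 ^ g.+1).-1 (iter i half (in_leaf v w)) < 2 ^ (g - i).+1
  /\ @inord (2 ^ g.+1).-1 (iter i half (in_leaf v w)) =
     iter i half (in_leaf v w) :> nat.
Proof.
move=> vw le_i.
have bnd := iter_half_bounds (in_leaf_bounds vw) le_i; rewrite heap_inordK //.
by case/andP: bnd => _ /leq_trans; apply; rewrite leq_exp2l // ltnS leq_subr.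
Qed.

Lemma legal_stepP (v w : D) : legal_step v w -> v = w \/ (v == w) = false /\ is_arc v w.
Proof.
rewrite /legal_step; case/orP=> [/eqP->|vw]; [by left | right; split=> //].
by apply: contraTF vw => /eqP->; rewrite is_arc_irr.
Qed.

Lemma bin_path_end v w : legal_step v w -> bin_path v w (h + g).+2 = in_root w.
Proof.
case/legal_stepP=> [->|[neq vw]]; rewrite /bin_path ?eqxx // neq.
rewrite ifF; last by lia.
have -> : (h + g).+1 - h.+1 = g by lia.
congr (_, inr _); apply: val_inj; rewrite /= in_root_val.
(* After [g] halvings the index is at least 1 and below 2, hence the root. *)
have [] := in_path_val vw (leqnn g); rewrite subnn => bnd _.
by move: bnd; rewrite expn1 expn0; lia.
Qed.

Lemma bin_path_step v w j : legal_step v w -> j < (h + g).+2 ->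
  legal_step (bin_path v w j : binarization) (bin_path v w j.+1).
Proof.
case/legal_stepP=> [->|[neq vw]] lt_j; rewrite /bin_path ?eqxx.
  by rewrite /legal_step eqxx.
rewrite neq; apply/orP; right; case: j lt_j => [_|i lt_i].
  rewrite /= eqxx in_root_val /= eqn_leq.
  by have [] := out_path_val vw (leq0n h); rewrite expn0 expn1; lia.
have [lt_h|ge_h] := ltnP i h.
  rewrite (ltnW lt_h) /= eqxx /=.
  have [bi ei] := out_path_val vw (ltnW lt_h).
  have [bi' ei'] := out_path_val vw lt_h.
  apply/andP; split; first by have := expn_gt0 2 i; lia.
  by rewrite ei ei' -(subnSK lt_h) iterS.
have [eq_h|gt_h] := eqVneq i h.
  rewrite eq_h leqnn !subnn /= vw.
  have [_ /=] := out_path_val vw (leqnn h); rewrite subnn /= => ->.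
  by have [_ /= ->] := in_path_val vw (leq0n g); rewrite !eqxx.
have [le1 le2] : i - h.+1 <= g /\ i.+1 - h.+1 <= g by lia.
rewrite ifF /= ?eqxx /=; last by lia.
have [_ ->] := in_path_val vw le1; have [bi ei] := in_path_val vw le2.
have -> : 0 < @inord (2 ^ g.+1).-1 (iter (i.+1 - h.+1) half (in_leaf v w)).
  by have := expn_gt0 2 (g - (i.+1 - h.+1)); lia.
rewrite ei; have -> : i.+1 - h.+1 = (i - h.+1).+1 by lia.
by rewrite iterS eqxx.
Qed.

(** For a moving robber the countdown at time [j] is [h.+2 - j] before the crossing and
    [L + h.+2 - j] after it, with [L = (h + g).+2]. For a waiting one [v = w], so whichever
    inequality holds will do. *)
Lemma bin_path_project v w j k : legal_step v w ->
  j < (h + g).+2 -> 0 < k -> j <= k <= j.+1 ->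
  ((bin_path v w j).1 = v /\ k + bin_distance (bin_path v w j) <= (h + g).+3) \/
  ((bin_path v w j).1 = w /\ (h + g).+3 < bin_distance (bin_path v w j) + k).
Proof.
case/legal_stepP=> [->|[neq vw]] lt_j k_gt0 jk; rewrite /bin_path ?eqxx ?neq.
  by rewrite bin_distance_root /=; case: (leqP (k + h.+2) (h + g).+3);
    [left | right]; split=> //; lia.
case: j lt_j jk => [_|i lt_i] jk.
  by left; rewrite bin_distance_root; split=> //; lia.
case: (leqP i h) => [le_h|gt_h]; rewrite /bin_distance /=.
  left; split=> //.
  by have [/trunc_log_eq-> //] := out_path_val vw le_h; lia.
right; split=> //.
have le_g : i - h.+1 <= g by lia.
by have [/trunc_log_eq-> //] := in_path_val vw le_g; lia.
Qed.

Lemma cops_win_binarization k : D -> cops_win binarization k -> cops_win D k.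
Proof.
apply: (@cops_win_project D binarization fst bin_distance (h + g).+2
  in_root bin_path) => //.
- exact: bin_distance_gt0.
- exact: bin_arc_project.
- by move=> v w; rewrite /bin_path; case: eqP.
- by move=> v w vw j; apply: bin_path_step.
- exact: bin_path_end.
- exact: bin_path_project.
Qed.

End Binarization.

(** * Choice of the tree depths and vertex count *)

Lemma up_log2_le n : 0 < n -> 2 ^ (up_log 2 n) <= 2 * n.
Proof.
case: n => [|[|n]] // _; have := @up_log_gtn 2 n.+2 isT isT.
by rewrite -{2}[up_log 2 n.+2]prednK ?up_log_gt0 // expnS; lia.
Qed.

Theorem theorem4p1 (D : digraph) (has_arc : exists u v : D, is_arc u v) :
  exists D' : digraph,
    [/\ cop_number D' >= cop_number D,
        max_out_degree D' <= 2 /\ max_in_degree D' <= 2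
      & #|D'| <= 4 * (max_in_degree D + max_out_degree D) * #|D|].
Proof.
case: has_arc => u [v uv].
have out_le (x : D) : out_degree x <= max_out_degree D by apply: leq_bigmax.
have in_le (x : D) : in_degree x <= max_in_degree D by apply: leq_bigmax.
exists (@binarization D (up_log 2 (max_out_degree D)) (up_log 2 (max_in_degree D))).
split.
- rewrite /cop_number; case: ex_minnP => k _ k_min.
  case: ex_minnP => k' /asboolP win' _; apply: k_min; apply/asboolP.
  by apply: cops_win_binarization win' => // x;
    [apply: leq_trans (out_le x) _ | apply: leq_trans (in_le x) _]; apply: up_logP.
- by split; [apply: max_out_degree_binarization | apply: max_in_degree_binarization].
(* The given arc makes both maximum degrees positive, so each power of two is at most twice its
   degree; a tree has twice as many indices as its power, whence the factor 4. *)
- have out_gt0 : 0 < max_out_degree D.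
    by apply: leq_trans (out_le u); apply/card_gt0P; exists v; rewrite inE.
  have in_gt0 : 0 < max_in_degree D.
    by apply: leq_trans (in_le v); apply/card_gt0P; exists u; rewrite inE.
  rewrite card_binarization leq_mul2r !expnS; apply/orP; right.
  by have := up_log2_le out_gt0; have := up_log2_le in_gt0; lia.
Qed.
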